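(* Let $p$ be a prime and let $G$ be a finite extraspecial $p$-group, meaning a finite $p$-group such that $Z(G) = G'$ and the quotient $G/Z(G)$ is a non-trivial elementary abelian $p$-group. Then $\mathrm{cod}(G) = \{ 1, p, (p\cdot |G|)^{1/2} \}$.
   Context: For an irreducible complex character $\chi$ of a finite group $G$, its codegree is $\mathrm{cod}(\chi) = |G:\ker\chi|/\chi(1)$, and $\mathrm{cod}(G) = \{\mathrm{cod}(\chi) : \chi \in \mathrm{Irr}(G)\}$, where $\mathrm{Irr}(G)$ is the set of irreducible complex characters of $G$. Here $Z(G)$ denotes the center of $G$ and $G'$ its commutator subgroup.
   Formalization: ''Extraspecial'' is taken in its usual sense, which also requires the center Z(G) to have order p; without this condition the claim fails, e.g. for E × E with E extraspecial of order p^3, which has p^2 as a codegree. *)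

(* Defs.v *)
From mathcomp Require Import all_boot all_order all_algebra all_fingroup.
From mathcomp Require Import all_solvable all_field all_character.

Set Implicit Arguments.
Unset Strict Implicit.
Unset Printing Implicit Defensive.

Import GroupScope GRing.Theory Num.Theory.

Definition codegree (gT : finGroupType) (G : {group gT}) (chi : 'CF(G)) : algC :=
  (#|G : cfker chi|%:R / chi 1%g)%R.

Definition codegrees (gT : finGroupType) (G : {group gT}) : seq algC :=
  [seq codegree chi | chi <- irr G].

(* Among p-groups, [extraspecial] (special with a center of prime order) is
   the usual textbook definition; the Frattini condition in [special] amounts
   to G / Z(G) being elementary abelian. *)
Lemma extraspecial_pgroupP (gT : finGroupType) (p : nat) (G : {group gT}) :
  prime p -> p.-group G ->
  extraspecial G <->
  [/\ 'Z(G) = G^`(1), p.-abelem (G / 'Z(G)), G / 'Z(G) != 1 & #|'Z(G)| = p].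
Proof.
move=> p_pr pG; split=> [esG | [ZG' abGZ ntGZ oZ]].
  have [[PhiZ G'Z] prZ] := esG.
  split=> //; first by rewrite -PhiZ Phi_quotient_abelem.
    apply/eqP=> GZ1; case/negP: (extraspecial_nonabelian esG).
    have sGZ: G \subset 'Z(G) by rewrite -quotient_sub1 ?GZ1 ?gFnorm.
    exact: abelianS sGZ (center_abelian G).
  exact: card_center_extraspecial pG esG.
split; last by rewrite oZ.
split=> //; apply/eqP; rewrite eqEsubset (Phi_min pG) ?gFnorm //=.
by rewrite ZG' (Phi_joing pG) joing_subl.
Qed.

(* Main.v *)
Require Import Defs.
From mathcomp Require Import all_boot all_order all_algebra all_fingroup.
From mathcomp Require Import all_solvable all_field all_character.

(** If [chi] is linear then [G / ker chi] is cyclic and is a quotient of the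
    elementary abelian group [G / G'], so it has order 1 or [p]. Otherwise
    [ker chi] does not contain [Z(G) = G'], which has prime order; hence
    [ker chi] meets [Z(G)] trivially, so [chi] is faithful. A faithful [chi] has
    central part [Z(chi) = Z(G)] with abelian quotient [G / Z(G)], which forces
    [chi(1)^2 = |G : Z(G)| = |G| / p] and [cod(chi)^2 = p |G|]. *)

Set Implicit Arguments.
Unset Strict Implicit.
Unset Printing Implicit Defensive.

Import GroupScope GRing.Theory Num.Theory.

Lemma codegree1 (gT : finGroupType) (G : {group gT}) :
  codegree (1 : 'CF(G)) = 1%R.
Proof. by rewrite /codegree cfker_cfun1 indexgg cfun11 divr1. Qed.

Lemma codegree_lin_char_abelem_der1 (gT : finGroupType) (p : nat)
    (G : {group gT}) (chi : 'CF(G)) :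
    p.-abelem (G / G^`(1)) -> chi \is a linear_char -> chi != 1%R ->
  codegree chi = p%:R%R.
Proof.
move=> abG' Lchi chi_neq1.
have [nsK sG'K] := (cfker_normal chi, lin_char_der1 Lchi).
(* A linear character has modulus 1 everywhere, so its center is all of [G]; cyclicity of
   ['Z(chi) / cfker chi] then passes to [G / cfker chi]. *)
have ZchiG : 'Z(chi)%CF = G.
  apply/eqP; rewrite eqEsubset cfcenter_sub; apply/subsetP=> x Gx.
  by rewrite char_cfcenterE ?lin_charW // normC_lin_char // lin_char1.
have cycGK : cyclic (G / cfker chi) by have := cfcenter_cyclic chi; rewrite ZchiG.
have abGK : p.-abelem (G / cfker chi).
  have := quotient_abelem (cfker chi / G^`(1)) abG'.
  by rewrite (isog_abelem (third_isog sG'K (der_normal 1 G) nsK)).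
have ntGK : G / cfker chi != 1.
  apply: contraNneq chi_neq1 => GK1; apply/eqP/cfun_inP=> x Gx.
  have Kx : x \in cfker chi.
    by apply: (subsetP _ x Gx); rewrite -quotient_sub1 ?normal_norm ?GK1.
  by rewrite cfun1E Gx (cfker1 Kx) lin_char1.
rewrite /codegree lin_char1 // divr1 -card_quotient ?normal_norm //.
by rewrite (cyclic_abelem_prime abGK cycGK ntGK).
Qed.

Lemma nonlinear_irr_faithful (gT : finGroupType) (G : {group gT})
    (chi : 'CF(G)) :
    nilpotent G -> extraspecial G -> chi \in irr G ->
    chi \isn't a linear_char ->
  cfaithful chi.
Proof.
move=> nilG [[_ G'Z] prZ] /irrP[i ->]; rewrite lin_irr_der1 G'Z => notZK.
(* In a nilpotent group, a normal subgroup meeting the center trivially is trivial. *)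
rewrite cfaithfulE (TI_center_nil nilG (cfker_normal _)) //.
by rewrite setIC prime_TIg.
Qed.

Lemma codegree_faithful_irr (gT : finGroupType) (G : {group gT})
    (chi : 'CF(G)) :
    abelian (G / 'Z(G)) -> chi \in irr G -> cfaithful chi ->
  codegree chi = sqrtC (#|'Z(G)|%:R * #|G|%:R)%R.
Proof.
move=> abGZ /irrP[i ->] faith; have := irr1_abelian_bound (i := i).
rewrite cfcenter_fful_irr // => /(_ abGZ) chi1_sq.
(* The codegree is nonnegative, hence the root of its square [|G|^2 / |G : Z(G)| = |Z(G)| |G|]. *)
rewrite /codegree (trivgP faith) indexg1 -[LHS]sqrCK; last first.
  by rewrite divr_ge0 ?ler0n ?char1_ge0 ?irr_char.
rewrite expr_div_n chi1_sq; congr (sqrtC _).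
by rewrite natf_indexg ?center_sub // invf_div mulrCA expr2 mulfK ?neq0CG.
Qed.

Theorem corollary2p5 (gT : finGroupType) (p : nat) (G : {group gT})
    (p_pr : prime p) (pG : p.-group G) (esG : extraspecial G) :
  codegrees G =i [:: 1; p%:R; sqrtC (p%:R * #|G|%:R)]%R.
Proof.
have [ZG' abGZ ntGZ oZ] := (extraspecial_pgroupP p_pr pG).1 esG.
have abG' : p.-abelem (G / G^`(1)) by rewrite -ZG'.
have codlin := codegree_lin_char_abelem_der1 abG'.
have codfaith := codegree_faithful_irr (abelem_abelian abGZ).
have nilG := pgroup_nil pG.
have ntG : G :!=: 1.
  by apply: contraNneq (extraspecial_nonabelian esG) => ->; apply: abelian1.
move=> c; apply/mapP/idP=> [[chi irr_chi ->]|].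
  have [Lchi|nLchi] := boolP (chi \is a linear_char); rewrite !inE.
    have [->|chi_neq1] := eqVneq chi 1%R; first by rewrite codegree1 eqxx.
    by rewrite codlin // eqxx orbT.
  by rewrite codfaith ?nonlinear_irr_faithful // oZ eqxx !orbT.
rewrite !inE => /or3P[] /eqP->.
- by exists 1%R; rewrite ?codegree1 // -irr0 mem_irr.
(* The value [p] is attained at any nontrivial linear character. *)
- have [i Li chi_neq1] := solvable_has_lin_char ntG (pgroup_sol pG).
  by exists ('chi_i)%R; rewrite ?mem_irr ?codlin.
(* The last value is attained at a faithful irreducible character, which a [p]-group with cyclic
   center possesses. *)
have cycZ : cyclic 'Z(G) by rewrite prime_cyclic ?oZ.
have [i faith] := pgroup_cyclic_faithful pG cycZ.
by exists ('chi_i)%R; rewrite ?mem_irr ?codfaith ?oZ ?mem_irr.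
Qed.
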